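(* Let $R$ be a commutative ring with non-zero identity and $I$ a proper ideal of $R$. The following are equivalent: (1) $I$ is a weakly $J$-ideal of $R$. (2) $(I:a)=I\cup(0:a)$ for every $a\in R\setminus J(R)$. (3) $(I:a)\subseteq J(R)\cup(0:a)$ for every $a\in R\setminus I$. (4) If $a\in R$ and $K$ is an ideal of $R$ with $0\neq Ka\subseteq I$, then $K\subseteq J(R)$ or $a\in I$. (5) If $K$ and $L$ are ideals of $R$ with $0\neq KL\subseteq I$, then $K\subseteq J(R)$ or $L\subseteq I$.
   Context: $J(R)$ denotes the Jacobson radical of $R$. For an ideal $I$ and $a\in R$, $(I:a)=\{x\in R: ax\in I\}$ and $(0:a)=\{x\in R: ax=0\}$. A proper ideal $I$ of $R$ is a weakly $J$-ideal if whenever $a,b\in R$ with $0\neq ab\in I$ and $a\notin J(R)$, then $b\in I$. *)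

(* Defs.v *)
From mathcomp Require Export all_boot all_algebra.
From mathcomp Require Export boolp classical_sets.

Set Implicit Arguments.
Unset Strict Implicit.
Unset Printing Implicit Defensive.

Import GRing.Theory.
Local Open Scope classical_set_scope.
Local Open Scope ring_scope.

(* [idealr_closed] of [ring_quotient] excludes the unit ideal, while arbitrary
   ideals are needed here. *)
Definition is_ideal (R : comNzRingType) (I : set R) : Prop :=
  [/\ I 0,
      forall x y : R, I x -> I y -> I (x + y)
    & forall r x : R, I x -> I (r * x)].

Definition is_proper_ideal (R : comNzRingType) (I : set R) : Prop :=
  is_ideal I /\ I <> setT.

Definition is_maximal_ideal (R : comNzRingType) (M : set R) : Prop :=
  is_proper_ideal M /\
  forall N : set R, is_ideal N -> M `<=` N -> N = M \/ N = setT.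

Definition jacobson_radical (R : comNzRingType) : set R :=
  \bigcap_(M in [set M : set R | is_maximal_ideal M]) M.
Arguments jacobson_radical : clear implicits.

(* [colon [set 0] a] is the annihilator (0 : a). *)
Definition colon (R : comNzRingType) (I : set R) (a : R) : set R :=
  [set x | I (a * x)].

(* The ideal product consists of finite sums of products, not of products
   alone. *)
Definition ideal_mul (R : comNzRingType) (K L : set R) : set R :=
  [set x | exists (n : nat) (k l : 'I_n -> R),
     [/\ forall i, K (k i), forall i, L (l i) & x = \sum_(i < n) k i * l i]].

Definition is_weakly_J_ideal (R : comNzRingType) (I : set R) : Prop :=
  is_proper_ideal I /\
  forall a b : R,
    0 <> a * b -> I (a * b) -> ~ jacobson_radical R a -> I b.

(* Main.v *)
(** An additive group is never the union of two proper subgroups. Given (3), an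
    ideal [K] as in (4) with [a] outside [I] lies in the union of [J(R)] and
    [(0 : a)]; given (4), an ideal [L] as in (5) with [K] outside [J(R)] lies in
    the union of [I] and the annihilator of [K]. The ideal therefore lies in one
    of the two, and not in the annihilator because the product is non-zero. *)
Require Import Defs.

Set Implicit Arguments.
Unset Strict Implicit.
Unset Printing Implicit Defensive.

Import GRing.Theory.
Local Open Scope classical_set_scope.
Local Open Scope ring_scope.

Lemma is_ideal_set0 (R : comNzRingType) : is_ideal [set 0 : R].
Proof. by split=> [|x y -> ->|r x ->] //=; rewrite ?addr0 ?mulr0. Qed.

Lemma is_ideal_principal (R : comNzRingType) (a : R) :
  is_ideal (range (fun r => r * a)).
Proof.
split=> [|_ _ [r _ <-] [s _ <-]|s _ [r _ <-]].
- by exists 0; rewrite ?mul0r.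
- by exists (r + s); rewrite ?mulrDl.
- by exists (s * r); rewrite ?mulrA.
Qed.

Lemma is_ideal_colon (R : comNzRingType) (I : set R) (a : R) :
  is_ideal I -> is_ideal (colon I a).
Proof.
case=> I0 ID IM; rewrite /colon; split=> [|x y Ix Iy|r x Ix] /=.
- by rewrite mulr0.
- by rewrite mulrDr; apply: ID.
- by rewrite mulrCA; apply: IM.
Qed.

(** Covers both the Jacobson radical and the annihilator of an ideal [K], taken as the intersection
    of [colon [set 0] k] over [k] in [K]. *)
Lemma is_ideal_bigcap (R : comNzRingType) (T : Type) (D : set T)
    (F : T -> set R) :
  (forall i, D i -> is_ideal (F i)) -> is_ideal (\bigcap_(i in D) F i).
Proof.
move=> idF; split=> [i Di|x y Fx Fy i Di|r x Fx i Di].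
- by have [] := idF i Di.
- by have [_ FD _] := idF i Di; apply: FD; [apply: Fx|apply: Fy].
- by have [_ _ FM] := idF i Di; apply: FM; apply: Fx.
Qed.

Lemma is_ideal_jacobson_radical (R : comNzRingType) :
  is_ideal (jacobson_radical R).
Proof. by apply: is_ideal_bigcap => M [[]]. Qed.

Lemma is_idealB (R : comNzRingType) (I : set R) (x y : R) :
  is_ideal I -> I x -> I y -> I (x - y).
Proof.
by case=> _ ID IM Ix Iy; apply: ID => //; rewrite -mulN1r; apply: IM.
Qed.

(** If some [y] in [K] is outside [B], then [y] is in [A]. For [x] in both [K] and [B], the sum
    [x + y] cannot be in [B], so it is in [A], and subtracting [y] puts [x] in [A]. *)
Lemma ideal_subsetU (R : comNzRingType) (K A B : set R) :
  is_ideal K -> is_ideal A -> is_ideal B -> K `<=` A `|` B ->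
  K `<=` A \/ K `<=` B.
Proof.
move=> [_ KD _] idA idB KAB.
have [|/existsNP[y /not_implyP[Ky nBy]]] := pselect (K `<=` B); first by right.
have Ay : A y by case: (KAB y Ky).
left=> x Kx; have [//|Bx] := KAB x Kx.
have [Axy|Bxy] := KAB _ (KD x y Kx Ky).
  by rewrite -(addrK y x); apply: is_idealB.
by case: nBy; rewrite -(addKr x y) addrC; apply: is_idealB.
Qed.

Lemma ideal_mulM (R : comNzRingType) (K L : set R) (k l : R) :
  K k -> L l -> ideal_mul K L (k * l).
Proof.
move=> Kk Ll; exists 1%N, (fun=> k), (fun=> l); split=> //.
by rewrite big_ord1.
Qed.

Lemma ideal_mul_eq0 (R : comNzRingType) (K L : set R) :
  (forall k l, K k -> L l -> k * l = 0) -> ideal_mul K L = [set 0].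
Proof.
move=> KL0; apply/seteqP; split=> [_ [n [k [l [Kk Ll ->]]]]|_ ->] /=.
  by apply: big1 => i _; apply: KL0.
(* The empty sum gives 0 even when [K] or [L] is empty. *)
by exists 0%N, (fun=> 0), (fun=> 0); split=> [[]//|[]//|]; rewrite big_ord0.
Qed.

Theorem theorem3 (R : comNzRingType) (I : set R) (hI : is_proper_ideal I) :
  [<-> is_weakly_J_ideal I;
       forall a : R, ~ jacobson_radical R a ->
         colon I a = I `|` colon [set 0] a;
       forall a : R, ~ I a ->
         colon I a `<=` jacobson_radical R `|` colon [set 0] a;
       forall (a : R) (K : set R), is_ideal K ->
         [set 0] <> [set k * a | k in K] -> [set k * a | k in K] `<=` I ->
         K `<=` jacobson_radical R \/ I a;
       forall K L : set R, is_ideal K -> is_ideal L ->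
         [set 0] <> ideal_mul K L -> ideal_mul K L `<=` I ->
         K `<=` jacobson_radical R \/ L `<=` I].
Proof.
have [idI _] := hI; have [I0 _ IM] := idI.
have id_ann a := is_ideal_colon a (@is_ideal_set0 R).
tfae=> [[_ wJ] a nJa | col a nIa x Iax | col a K idK Ka0 KaI
       | elt K L idK idL KL0 KLI | mul].
- apply/seteqP; split=> [x Iax|x [Ix|ax0]].
  + have [ax0|/nesym nz] := pselect (a * x = 0); first by right.
    by left; apply: wJ nz Iax nJa.
  + exact: IM.
  + by rewrite /colon /= ax0.
- have [|nJx] := pselect (jacobson_radical R x); first by left.
  (* The roles of [a] and [x] are exchanged: [x] is in [(I : a)] exactly when [a] is in [(I : x)],
     and (2) applies at [x], which is outside the radical. *)
  right; have : colon I x a by rewrite /colon /= mulrC.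
  by rewrite (col x nJx) /colon /= mulrC => -[].
- have [|nIa] := pselect (I a); [by right|left].
  have KU : K `<=` jacobson_radical R `|` colon [set 0] a.
    by move=> k Kk; apply: (col a nIa); rewrite /colon /= mulrC; apply: KaI;
       exists k.
  have [//|K0] := ideal_subsetU idK (@is_ideal_jacobson_radical R) (id_ann a) KU.
  case: Ka0; apply/esym/seteqP; split=> [_ [k Kk <-]|_ ->] /=.
    by rewrite mulrC; apply: K0.
  by exists 0; [case: idK|rewrite mul0r].
- have [|nKJ] := pselect (K `<=` jacobson_radical R); [by left|right].
  have LU : L `<=` I `|` \bigcap_(k in K) colon [set 0] k.
    move=> l Ll; have [|nIl] := pselect (I l); [by left|right=> k Kk].
    (* If [k * l] were non-zero, (4) would apply to [l] and [K], since [Kl] is then non-zero and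
       lies in [KL], hence in [I]; both of its outcomes are already excluded. *)
    apply: contrapT => kl0; have [||//|//] := elt l K idK.
      by move=> Kl; apply: kl0; change ([set 0] (k * l)); rewrite Kl; exists k.
    by move=> _ [k' Kk' <-]; apply: KLI; apply: ideal_mulM.
  have idA := is_ideal_bigcap (fun k (_ : K k) => id_ann k).
  have [//|L0] := ideal_subsetU idL idI idA LU.
  by case: KL0; rewrite ideal_mul_eq0 // => k l Kk /L0; apply.
- split=> // a b ab0 Iab nJa.
  (* Use (5) for the principal ideals of [a] and [b]. Their product contains [a * b], so it is
     non-zero, and each term [(r * a) * (s * b)] equals [(r * s) * (a * b)], which lies in [I]. *)
  have aa : range (fun r => r * a) a by exists 1; rewrite ?mul1r.
  have bb : range (fun r => r * b) b by exists 1; rewrite ?mul1r.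
  have [||KJ|] := mul _ _ (is_ideal_principal a) (is_ideal_principal b).
  + move=> E; apply: ab0.
    by have : [set 0] (a * b) by rewrite E; apply: ideal_mulM.
  + move=> _ [n [k [l [ka lb ->]]]]; have [_ ID _] := idI.
    apply: (big_ind I) => // i _.
    have [r _ <-] := ka i; have [s _ <-] := lb i.
    by rewrite mulrACA; apply: IM.
  + by case: nJa; apply: KJ.
  + exact.
Qed.
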